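(* For any increasing function $f:\mathbb{N}\to\mathbb{N}$, $\mathcal{L}_{B_f}(n) \preceq \exp(\exp(n))$.
   Context: $\mathbb{N}=\{1,2,\ldots\}$. For groups $\Gamma,\Delta$ and $F\subseteq\Gamma$, a local embedding of $F$ into $\Delta$ is an injective function $\pi:F\to\Delta$ such that for all $g,h\in F$, if $gh\in F$ then $\pi(gh)=\pi(g)\pi(h)$. For a group $\Gamma$ generated by a finite set $S$, let $B_S(n)$ be the closed ball of radius $n$ around the identity in the word metric of $S$. LEF growth: $\mathcal{L}_\Gamma^S(n)=\min\{|Q| : Q$ a finite group for which there is a local embedding $B_S(n)\to Q\}$ ($\infty$ if there is none). Comparison: for functions $f_1,f_2$ from $\mathbb{N}$ to $(0,\infty)$, $f_1\preceq f_2$ means that there is a constant $C>0$ with $f_1(n)\le f_2(Cn)$ for all $n\in\mathbb{N}$, where functions on $\mathbb{N}$ are evaluated at real $x>0$ by $f(x)=f(\lceil x\rceil)$. Up to the equivalence ($f_1\preceq f_2$ and $f_2\preceq f_1$) $\mathcal{L}_\Gamma^S$ does not depend on the finite generating set $S$, and one writes $\mathcal{L}_\Gamma$. The groups $N(d,q)$: for $m\in\mathbb{N}$, $m\geq 3$, let $\alpha_m=(1\;2\cdots m)$ and $\beta_m=(1\;2\;3)$ in $\mathrm{Sym}(m)$. For functions $d,q:\mathbb{N}\to\mathbb{N}$ with all values of $d$ odd integers at least $5$, let $s=(\alpha_{d(n)}^{q(n)})_n$ and $t=(\beta_{d(n)})_n$ in $\prod_{n\in\mathbb{N}}\mathrm{Alt}(d(n))$,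 and let $N(d,q)=\langle s,t\rangle$. The groups $B_f$: given an increasing function $f:\mathbb{N}\to\mathbb{N}$ with $f(n)\ge n$ for all $n$ (automatic for strictly increasing $f$), there exist functions $d,p,q:\mathbb{N}\to\mathbb{N}$ such that for all $n$: (i) $p$ is odd-valued, strictly increasing and $p(1)=1$; (ii) $q(n)\ge 3$ is odd; (iii) $d(n)=p(n)q(n)+2$; (iv) $d(n)\ge 2f(4p(n+1)+4)$ is odd; (v) for all $i\le n$, $p(n+1)q(i)\not\equiv \pm1,\pm2 \pmod{d(i)}$. Fix such $d,p,q$ and set $B_f=N(d,q)$. *)

(* Defs.v *)
From HB Require Import structures.
From mathcomp Require Import all_boot all_order all_algebra all_fingroup.
From mathcomp Require Import all_classical all_reals all_analysis.

Set Implicit Arguments.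
Unset Strict Implicit.
Unset Printing Implicit Defensive.

Import Order.TTheory GRing.Theory Num.Theory.

Local Open Scope classical_set_scope.
Local Open Scope group_scope.

(* Positive integers are elements [n] of [nat] with [0 < n]; the value at [0]
   of a function on the positive integers is never used. *)

Definition prod_group (I : Type) (G : I -> groupType) := forall i, G i.

Section ProdGroup.
Variables (I : Type) (G : I -> groupType).
Implicit Types x y z : prod_group G.

HB.instance Definition _ := Choice.on (prod_group G).

Let one : prod_group G := fun=> 1.
Let inv x : prod_group G := fun i => (x i)^-1.
Let mul x y : prod_group G := fun i => x i * y i.

Let mulA : associative mul.
Proof. by move=> x y z; apply: functional_extensionality_dep => i; apply: mulgA. Qed.
Let mul1 : left_id one mul.
Proof. by move=> x; apply: functional_extensionality_dep => i; apply: mul1g. Qed.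
Let mulr1 : right_id one mul.
Proof. by move=> x; apply: functional_extensionality_dep => i; apply: mulg1. Qed.
Let mulVx : left_inverse one inv mul.
Proof. by move=> x; apply: functional_extensionality_dep => i; apply: mulVg. Qed.
Let mulxV : right_inverse one inv mul.
Proof. by move=> x; apply: functional_extensionality_dep => i; apply: mulgV. Qed.

HB.instance Definition _ :=
  isGroup.Build (prod_group G) mulA mul1 mulr1 mulVx mulxV.

End ProdGroup.

Section Growth.
Variables (R : realType) (G : groupType).
Implicit Types (S F H : set G).

Definition is_subgroup H :=
  [/\ H 1, (forall x y, H x -> H y -> H (x * y)) & (forall x, H x -> H x^-1)].

Definition subgroup_gen S : set G := smallest is_subgroup S.

(* B_S(n), a subset of [subgroup_gen S]: the products of at most [n] elements of
   S \cup S^-1 *)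
Definition word_ball S (n : nat) : set G :=
  [set g | exists w : seq G, [/\ (size w <= n)%N,
    (forall x, x \in w -> S x \/ S x^-1) & g = \prod_(x <- w) x]].

(* [pi] is only constrained on [F], so it stands for a function on [F]. *)
Definition local_embedding F (D : groupType) (pi : G -> D) :=
  (forall g h, F g -> F h -> pi g = pi h -> g = h) /\
  (forall g h, F g -> F h -> F (g * h) -> pi (g * h) = pi g * pi h).

Definition embeds_in_order F (m : nat) :=
  exists Q : finGroupType, #|Q| = m /\ exists pi : G -> Q, local_embedding F pi.

(* The LEF growth of the group [subgroup_gen S] with respect to [S]. *)
Definition LEF_growth S (n : nat) : \bar R :=
  match pselect (exists m, `[< embeds_in_order (word_ball S n) m >]) with
  | left ex => ((ex_minn ex)%:R)%:E
  | right _ => +oo%E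
  end.

End Growth.

(* A function on the positive integers at a real x > 0, via the ceiling of x. *)
Definition eval_real (R : realType) (T : Type) (f : nat -> T) (x : R) : T :=
  f `|Num.ceil x|%N.

Definition growth_le (R : realType) (f1 f2 : nat -> \bar R) :=
  exists2 C : R, (0 < C)%R &
    forall n : nat, (0 < n)%N -> (f1 n <= eval_real f2 (C * n%:R)%R)%E.

(* The points 1, ..., m are numbered 0, ..., m - 1, and [s * t] is "s, then t".
   The m-cycle (1 2 ... m). *)
Definition alpha_perm (m : nat) : 'S_m := perm (@ordS_inj m).

(* The 3-cycle (1 2 3); the junk value for m < 3 is not used. *)
Definition beta_perm (m : nat) : 'S_m :=
  match m return 'S_m with
  | k.+3 => tperm (@Ordinal k.+3 0 isT) (@Ordinal k.+3 1 isT) *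
            tperm (@Ordinal k.+3 0 isT) (@Ordinal k.+3 2 isT)
  | _ => 1
  end.

(* The factor indexed by the positive integer n + 1 is the coordinate n.
   For odd d, [gen_s] and [gen_t] below lie in the product of the 'Alt
   subgroups, so generating in the product of the 'S_(d n) is the same. *)
Definition sym_product (d : nat -> nat) : groupType :=
  prod_group (fun n : nat => 'S_(d n.+1) : groupType).

Definition gen_s (d q : nat -> nat) : sym_product d :=
  fun n => alpha_perm (d n.+1) ^+ q n.+1.

Definition gen_t (d : nat -> nat) : sym_product d := fun n => beta_perm (d n.+1).

Arguments gen_s : clear implicits.
Arguments gen_t : clear implicits.

Definition N_group (d q : nat -> nat) : set (sym_product d) :=
  subgroup_gen [set gen_s d q; gen_t d].

Arguments N_group : clear implicits.

(* The conditions under which B_f is N_group d q. *)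
Record B_parameters (f d p q : nat -> nat) : Prop := {
  p_odd : forall n, (0 < n)%N -> odd (p n);
  p_incr : forall m n, (0 < m)%N -> (m < n)%N -> (p m < p n)%N;
  p_1 : p 1%N = 1%N;
  q_ge3 : forall n, (0 < n)%N -> (3 <= q n)%N;
  q_odd : forall n, (0 < n)%N -> odd (q n);
  d_eq : forall n, (0 < n)%N -> d n = (p n * q n + 2)%N;
  d_ge : forall n, (0 < n)%N -> (2 * f (4 * p n.+1 + 4) <= d n)%N;
  d_odd : forall n, (0 < n)%N -> odd (d n);
  pq_neq : forall n i, (0 < i)%N -> (i <= n)%N ->
    forall e : int, e \in [:: 1; -1; 2; -2]%R ->
      ~ ((p n.+1 * q i)%N%:Z = e %[mod (d i)%:Z])%Z
}.

(* Main.v *)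
(* Fix a word length N.  In the coordinate with parameters d = p q + 2, the points
   j + q k (j = 0, 1, 2 and k an integer) of Z/d are shifted by s (k becomes k + 1),
   and t rotates the three points with k = 0.  Since p q = -2 and d is odd,
   j + q k = j' + q k' mod d if and only if 2 k - p j = 2 k' - p j' mod d, and for
   |k|, |k'| <= N and d > 4 p + 4 N this is an equality of integers.  Following a
   point along a word of length at most N only tests such coincidences, so whether
   the word is trivial depends only on min(p, 4 N + 1).  Hence each coordinate with
   d > 4 p + 4 N + 2 may be replaced by the one with parameters
   p' = min(p, 4 N + 1) and q' = 8 N + 9, of degree O(N^2), and all coordinates of
   index above 4 N impose the same condition, because p(n) >= n.  The elements of
   length N / 3 therefore embed locally into a product of 4 N + 1 symmetric groups
   of degree O(N^2), whose order is at most 2^(2^(22 N)). *)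

Require Import Defs.
From mathcomp Require Import all_boot all_order all_algebra all_fingroup.
From mathcomp Require Import all_classical all_reals all_analysis.
From mathcomp Require Import zify ring lra.

Set Implicit Arguments.
Unset Strict Implicit.
Unset Printing Implicit Defensive.

Import Order.TTheory GRing.Theory Num.Theory.

Local Open Scope group_scope.

(** * Words in two generators and their inverses *)

Definition letter_val (G : groupType) (a b : G) (l : bool * bool) : G :=
  let g := if l.1 then a else b in if l.2 then g^-1 else g.

Definition word_val (G : groupType) (a b : G) (w : seq (bool * bool)) : G :=
  \prod_(l <- w) letter_val a b l.

Definition exponent (w : seq (bool * bool)) : int :=
  (\sum_(l <- w | l.1) (-1) ^+ l.2)%R.

Lemma word_val_cons (G : groupType) (a b : G) l w :
  word_val a b (l :: w) = letter_val a b l * word_val a b w.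
Proof. exact: big_cons. Qed.

Lemma exponent_cons l w :
  exponent (l :: w) = ((if l.1 then (-1) ^+ l.2 else 0) + exponent w)%R.
Proof. by rewrite /exponent big_cons; case: l.1; rewrite ?add0r. Qed.

(** * Following points along words, and comparing two models *)

Section LineModel.
Local Open Scope ring_scope.

(* [P j k] is a lift of a point to one of three copies of the integers; the copies
   may overlap. *)
Record line_model (T : finType) (a b : {perm T}) (P : 'I_3 -> int -> T) :
    Prop := {
  line_step : forall j k, a (P j k) = P j (k + 1);
  line_turn : forall j, b (P j 0) = P (j + 1) 0;
  line_fix : forall x, (forall j, x <> P j 0) -> b x = x;
  line_shift : forall i j k l e, P i (k + e) = P j (l + e) -> P i k = P j l;
  line_onto : forall x, exists k, x = P 0 k
}.

Section Act.
Variables (T : finType) (a b : {perm T}) (P : 'I_3 -> int -> T).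
Hypothesis M : line_model a b P.

Lemma line_step_letter j k v :
  letter_val a b (true, v) (P j k) = P j (k + (-1) ^+ v).
Proof.
case: v; rewrite /letter_val /= ?expr0 ?expr1; last exact: line_step M _ _.
by rewrite -[k in LHS](subrK 1) -(line_step M) permK.
Qed.

Lemma line_turn_letter j v :
  letter_val a b (false, v) (P j 0) = P (j + (-1) ^+ v) 0.
Proof.
case: v; rewrite /letter_val /= ?expr0 ?expr1; last exact: line_turn M _.
by rewrite -[j in LHS](subrK 1) -(line_turn M) permK.
Qed.

Lemma line_fix_letter x v :
  (forall j, x <> P j 0) -> letter_val a b (false, v) x = x.
Proof.
move=> /(line_fix M) bx; case: v; rewrite /letter_val //=.
by rewrite -[in LHS]bx permK.
Qed.

Lemma line_shift_add i j k l e : P i k = P j l -> P i (k + e) = P j (l + e).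
Proof. by move=> E; apply: (line_shift M (e := - e)); rewrite !addrK. Qed.

(** No prefix brings such a point to a turning point [P i 0], so every letter in [b] fixes it. The
    integer [e] is the exponent of the prefix already read; the induction needs it arbitrary. *)
Lemma word_far (N : nat) j k u (e : int) :
  (forall i l, `|l| <= N%:Z -> P j k <> P i l) ->
  `|e| + (size u)%:Z <= N%:Z ->
  word_val a b u (P j (k + e)) = P j (k + e + exponent u).
Proof.
move=> far; elim: u e => [|[c v] u IH] e.
  by rewrite /word_val /exponent !big_nil perm1 !addr0.
rewrite /= => he; rewrite word_val_cons exponent_cons permM /=.
case: c; last first.
  have he' : `|e| + (size u)%:Z <= N%:Z by lia.
  rewrite add0r line_fix_letter; first exact: IH.
  move=> i E; apply: (far i (- e)); first by lia.
  by apply: (line_shift M (e := e)); rewrite E addNr.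
rewrite line_step_letter -(addrA k e) IH; first by rewrite !addrA.
by case: v; rewrite ?expr0 ?expr1; lia.
Qed.

End Act.

Section Compare.
Variables (T : finType) (a b : {perm T}) (P : 'I_3 -> int -> T).
Variables (T' : finType) (a' b' : {perm T'}) (P' : 'I_3 -> int -> T').
Hypotheses (M : line_model a b P) (M' : line_model a' b' P').
Variable N : nat.
Hypothesis PP' : forall i j (k l : int), `|k| <= N%:Z -> `|l| <= N%:Z ->
  P i k = P j l <-> P' i k = P' j l.

(* Both points of the pair stay of the form [P j (k + e)], [P' j (k + e)] with
   [|k| <= N], where [e] is the exponent of the prefix read so far. *)
Lemma word_near j (k : int) u (e : int) : `|k| <= N%:Z -> `|e| + (size u)%:Z <= N%:Z ->
  exists j' k', [/\ `|k'| <= N%:Z,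
    word_val a b u (P j (k + e)) = P j' (k' + e + exponent u) &
    word_val a' b' u (P' j (k + e)) = P' j' (k' + e + exponent u)].
Proof.
elim: u e j k => [|[c v] u IH] e j k hk he.
  by exists j, k; rewrite /word_val /exponent !big_nil !perm1 addr0.
rewrite !word_val_cons exponent_cons !permM /=; rewrite /= in he.
case: c.
  rewrite (line_step_letter M) (line_step_letter M') -addrA.
  have [|j' [k' [hk' E E']]] := IH (e + (-1) ^+ v) j k hk.
    by case: v he; rewrite ?expr0 ?expr1; lia.
  by exists j', k'; split=> //; rewrite ?E ?E' !addrA.
have he' : `|e| + (size u)%:Z <= N%:Z by lia.
have hNe : `|- e| <= N%:Z by lia.
rewrite add0r.
(* At a turning point [P i 0], undoing the shift by [e] gives [P j k = P i (- e)], a coincidence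
   within range [N] that [PP'] transfers. The new [k'] is then [- e]. *)
have [[i E]|nE] := pselect (exists i, P j (k + e) = P i 0).
  have E' : P' j (k + e) = P' i 0.
    rewrite -(addNr e); apply: (line_shift_add M'); apply/PP' => //.
    by apply: (line_shift M (e := e)); rewrite E addNr.
  rewrite E E' (line_turn_letter M) (line_turn_letter M') -(addNr e).
  exact: IH.
rewrite (line_fix_letter M) ?(line_fix_letter M'); first exact: IH.
- move=> i E'; apply: nE; exists i; rewrite -(addNr e).
  apply: (line_shift_add M); apply/PP' => //.
  by apply: (line_shift M' (e := e)); rewrite E' addNr.
- by move=> i E; apply: nE; exists i.
Qed.

(* A point that short words only shift: it forces a trivial word to have
   exponent 0. *)
Hypothesis far : exists k : int,
  (forall j l, `|l| <= N%:Z -> P 0 k <> P j l) /\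
  (forall e, `|e| <= N%:Z -> P 0 (k + e) = P 0 k -> e = 0).

(** Points [P' j l] with [|l| <= N] move as their counterparts in the first model, where [u] is
    trivial; all other points are merely shifted by the exponent, which is 0. *)
Lemma line_trivial_word u : (size u <= N)%N ->
  word_val a b u = 1%g -> word_val a' b' u = 1%g.
Proof.
move=> hu u1.
have hu' : `|0 : int| + (size u)%:Z <= N%:Z by lia.
have hex : `|exponent u| <= (size u)%:Z.
  elim: {hu u1 hu'} u => [|[c v] u IH]; first by rewrite /exponent big_nil.
  rewrite exponent_cons /=.
  by case: c; case: v; rewrite ?expr0 ?expr1; lia.
have eu0 : exponent u = 0.
  have [k [fark freek]] := far; apply: freek; first by lia.
  by have := word_far M fark hu'; rewrite u1 perm1 addr0.
apply/permP => y; rewrite perm1.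
have [k ->] := line_onto M' y.
have [[j [l [hl E]]]|nE] := pselect (exists j l, `|l| <= N%:Z /\ P' 0 k = P' j l).
  have [j' [l' [hl' F F']]] := word_near j hl hu'.
  rewrite E; move: F F'; rewrite eu0 !addr0 => F ->.
  by apply/esym/PP' => //; rewrite -F u1 perm1.
rewrite -[k in LHS]addr0 (word_far M' (N := N)) ?eu0 ?addr0 //.
by move=> i l hl E; apply: nE; exists i, l.
Qed.

End Compare.
End LineModel.

(** * The cycle Z/d as a line model *)

Section CyclicModel.
Local Open Scope ring_scope.

(** Multiplying [x + q * k] by [- p] gives [2 * k - p * x]; multiplying that by [q] gives
    [2 * (x + q * k)], and [h] inverts 2. *)
Lemma line_coordinate_eq (R : comNzRingType) (p q h x y k l : R) :
  p * q = - 2 -> 2 * h = 1 ->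
  x + q * k = y + q * l <-> 2 * k - p * x = 2 * l - p * y.
Proof.
move=> pq h2.
have px z m : 2 * m - p * z = - p * (z + q * m).
  by rewrite mulrDr mulrA !mulNr pq; ring.
have qx z m : z + q * m = h * (q * (2 * m - p * z)).
  transitivity (2 * h * (z + q * m)); first by rewrite h2 mul1r.
  have -> : q * (2 * m - p * z) = 2 * (q * m) - p * q * z by ring.
  by rewrite pq; ring.
by split=> E; [rewrite !px E | rewrite !qx E].
Qed.

Variables (c p q : nat).
Hypotheses (cE : c.+3 = (p * q + 2)%N) (p_odd : odd p) (q_odd : odd q).

Notation Zd := 'I_c.+3.

(** The degree is written [c.+3] so that ['I_c.+3] carries its ring structure and [beta_perm]
    reduces to the 3-cycle. *)
Definition cyc_point (j : 'I_3) (k : int) : Zd := (j : nat)%:R + q%:R * k%:~R.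

(** With [d = c.+3] odd, [(d + 1) / 2] is the inverse of 2 modulo [d]. *)
Let half : Zd := (c.+4./2)%:R.

Lemma cyc_pq : p%:R * q%:R = - 2 :> Zd.
Proof.
apply/eqP; rewrite -subr_eq0 opprK -natrM -(natrD _ _ 2) -cE.
by apply/eqP/val_inj; rewrite Zp_nat /= modnn.
Qed.

Lemma cyc_half : 2 * half = 1 :> Zd.
Proof.
have c_odd : odd c.+3 by rewrite cE oddD oddM p_odd q_odd.
rewrite /half -natrM.
have -> : (2 * c.+4./2 = 1 + c.+3)%N by lia.
by apply/val_inj; rewrite natrD !Zp_nat /= modnn addn0 modn_mod.
Qed.

Lemma cyc_intr_eq0 (z : int) : `|z| < c.+3%:Z -> z%:~R = 0 :> Zd -> z = 0.
Proof.
have nat_eq0 n : (n < c.+3)%N -> n%:R = 0 :> Zd -> n = 0.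
  by move=> hn; rewrite Zp_nat => /(congr1 val) /=; rewrite modn_small.
case: z => n hn; first by rewrite -pmulrn => /nat_eq0 ->.
rewrite NegzE rmorphN /= -pmulrn => /eqP; rewrite oppr_eq0 => /eqP/nat_eq0.
by move=> -> //; lia.
Qed.

Lemma cyc_point_eq i j k l :
  cyc_point i k = cyc_point j l <->
  (2 * k - p%:Z * i%:Z - (2 * l - p%:Z * j%:Z))%:~R = 0 :> Zd.
Proof.
rewrite (line_coordinate_eq _ _ _ _ cyc_pq cyc_half).
rewrite !(rmorphB, rmorphM) /=.
by split=> [->|/eqP]; [rewrite subrr | rewrite subr_eq0 => /eqP].
Qed.

Lemma alpha_permX (n : nat) (x : Zd) : (alpha_perm c.+3 ^+ n)%g x = x + n%:R.
Proof.
rewrite permX; elim: n => [|n IH]; first by rewrite addr0.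
rewrite iterS IH /alpha_perm permE -(@add_Zp_1 c.+3).
by rewrite -addrA -(natrD _ n 1) addn1.
Qed.

Lemma cyc_line_model :
  line_model (alpha_perm c.+3 ^+ q) (beta_perm c.+3) cyc_point.
Proof.
have p0 (j : 'I_3) : cyc_point j 0 = inord j.
  rewrite /cyc_point mulr0 addr0; apply/val_inj.
  by rewrite /= Zp_nat /= inordK ?modn_small //; have := ltn_ord j; lia.
have o0 : @Ordinal c.+3 0 isT = inord 0 by apply/val_inj; rewrite /= inordK.
have o1 : @Ordinal c.+3 1 isT = inord 1 by apply/val_inj; rewrite /= inordK.
have o2 : @Ordinal c.+3 2 isT = inord 2 by apply/val_inj; rewrite /= inordK.
split.
- by move=> j k; rewrite alpha_permX /cyc_point rmorphD /= mulrDr mulr1 addrA.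
- move=> j; rewrite !p0 /beta_perm permM o0 o1 o2.
  have E (m n : nat) : (m < 3)%N -> (n < 3)%N ->
      (inord m == inord n :> Zd) = (m == n).
    by move=> hm hn; rewrite -val_eqE /= !inordK //; lia.
  by case: j => [[|[|[|//]]] hj] /=;
    rewrite !permE /= !(fun_if, E, permE) //= ?E.
- move=> x nx; rewrite /beta_perm permM o0 o1 o2.
  have nx' m : (m < 3)%N -> inord m != x.
    by move=> hm; apply/eqP => E; apply: (nx (inord m)); rewrite p0 inordK.
  by rewrite !tpermD ?nx'.
- move=> i j k l e; rewrite /cyc_point !rmorphD /= !mulrDr !addrA.
  exact: addIr.
(* The witness is [k = - x p / 2], since [q k = - p q x / 2 = x]. *)
- move=> x; exists ((nat_of_ord (x * (- p%:R) * half))%:Z).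
  rewrite /cyc_point add0r -pmulrn natr_Zp.
  transitivity (2 * half * x); first by rewrite cyc_half mul1r.
  have -> : q%:R * (x * - p%:R * half) = - (p%:R * q%:R) * (half * x) by ring.
  by rewrite cyc_pq; ring.
Qed.

End CyclicModel.

(** * Comparing two cycles on short words *)

Definition cyc_trivial (d q : nat) (u : seq (bool * bool)) : Prop :=
  word_val (alpha_perm d ^+ q) (beta_perm d) u = 1.

Section CompareCycles.
Local Open Scope ring_scope.

(** The two sides differ by at most [2 p + 4 N], which is below the modulus. *)
Lemma cyc_point_small_eq c p q N (i j : 'I_3) (k l : int) :
  c.+3 = (p * q + 2)%N -> odd p -> odd q -> (4 * p + 4 * N + 2 < c.+3)%N ->
  `|k| <= N%:Z -> `|l| <= N%:Z ->
  cyc_point c q i k = cyc_point c q j l <->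
  2 * k - p%:Z * i%:Z = 2 * l - p%:Z * j%:Z.
Proof.
move=> cE po qo hc hk hl; rewrite (cyc_point_eq cE) //; split; last first.
  by move=> ->; rewrite subrr.
move/cyc_intr_eq0 => H; apply/eqP; rewrite -subr_eq0; apply/eqP/H.
by case: i j {H} => [[|[|[|//]]] ?] [[|[|[|//]]] ?] /=; lia.
Qed.

Lemma cyc_trivial_compare N p q p' q' u :
  odd p -> odd q -> odd p' -> odd q' ->
  (4 * p + 4 * N < p * q)%N -> (4 * p' + 4 * N < p' * q')%N ->
  minn p (4 * N).+1 = minn p' (4 * N).+1 -> (size u <= N)%N ->
  cyc_trivial (p * q + 2) q u -> cyc_trivial (p' * q' + 2) q' u.
Proof.
move=> po qo po' qo' hd hd' pp' hu.
have [c cE] : exists c, c.+3 = (p * q + 2)%N by exists (p * q).-1; lia.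
have [c' cE'] : exists c, c.+3 = (p' * q' + 2)%N by exists (p' * q').-1; lia.
rewrite -cE -cE'.
have M := cyc_line_model cE po qo; have M' := cyc_line_model cE' po' qo'.
apply: (line_trivial_word M M' (N := N)) => //.
  move=> i j k l hk hl.
  rewrite (cyc_point_small_eq _ _ cE po qo _ hk hl); last by lia.
  rewrite (cyc_point_small_eq _ _ cE' po' qo' _ hk hl); last by lia.
  (* Both conditions read [2 (k - l) = p (i - j)] with [|2 (k - l)| <= 4 N]. Either [p = p'], or
     both exceed [4 N] and only [i = j], [k = l] remains. *)
  by case: i j => [[|[|[|//]]] ?] [[|[|[|//]]] ?] /=; lia.
(* For this [k], [2 k - 2 l + p j] lies between [2 p + 2] and [4 p + 4 N + 2 < d], so it is nonzero
   modulo [d]. *)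
exists (p%:Z + N%:Z + 1); split=> [j l hl|].
  move=> /(cyc_point_eq cE po qo) /cyc_intr_eq0.
  by case: j => [[|[|[|//]]] ?] /= H; have := H ltac:(lia); lia.
move=> e he /(cyc_point_eq cE po qo) /cyc_intr_eq0 H.
by have := H ltac:(rewrite /= ; lia); lia.
Qed.

End CompareCycles.

(** * From short relations to local embeddings of balls *)

Section Words.
Variables (G : groupType) (a b : G).

Lemma word_val_cat u v :
  word_val a b (u ++ v) = word_val a b u * word_val a b v.
Proof. exact: big_cat. Qed.

Definition word_inv (u : seq (bool * bool)) :=
  rev [seq (l.1, ~~ l.2) | l <- u].

Lemma size_word_inv u : size (word_inv u) = size u.
Proof. by rewrite size_rev size_map. Qed.

Lemma word_val_inv u : word_val a b (word_inv u) = (word_val a b u)^-1.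
Proof.
elim: u => [|[c v] u IH]; first by rewrite /word_val !big_nil invg1.
rewrite /word_inv /= rev_cons -cats1 word_val_cat [X in X * _]IH.
rewrite [in RHS]word_val_cons invMg; congr (_ * _).
by rewrite /word_val big_seq1 /letter_val; case: c; case: v => /=; rewrite ?invgK.
Qed.

End Words.

Lemma word_valM (G H : groupType) (phi : G -> H) (a b : G) u :
  (forall x y, phi (x * y) = phi x * phi y) ->
  phi (word_val a b u) = word_val (phi a) (phi b) u.
Proof.
move=> phiM.
have phi1 : phi 1 = 1 by apply: (mulgI (phi 1)); rewrite -phiM !mulg1.
have phiV x : phi x^-1 = (phi x)^-1.
  by apply: (mulgI (phi x)); rewrite -phiM !mulgV.
rewrite /word_val (big_morph phi phiM phi1).
by apply: eq_bigr => -[[] []] _; rewrite /letter_val /= ?phiV.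
Qed.

Definition word_values (G : groupType) (a b : G) (n : nat) : set G :=
  [set g | exists2 u, (size u <= n)%N & g = word_val a b u].

(** Choose a word of length at most [n] for each element of [F] and read it in [Q]. Injectivity
    tests words of length [2 n], multiplicativity words of length [3 n]. *)
Lemma embeds_word_values (G : groupType) (Q : finGroupType) (a b : G)
    (a' b' : Q) (n : nat) (F : set G) :
  (forall g, F g -> word_values a b n g) ->
  (forall u, (size u <= 3 * n)%N ->
     word_val a b u = 1 <-> word_val a' b' u = 1) ->
  embeds_in_order F #|Q|.
Proof.
move=> Fn ab; exists Q; split=> //.
have /choice[wd wdP] : forall g, exists u, F g ->
    (size u <= n)%N /\ word_val a b u = g.
  move=> g; have [Fg|nFg] := pselect (F g); last by exists [::].
  by have [u hu ->] := Fn _ Fg; exists u.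
exists (fun g => word_val a' b' (wd g)); split.
- move=> g h Fg Fh E; have [sg <-] := wdP g Fg; have [sh <-] := wdP h Fh.
  have : word_val a b (word_inv (wd g) ++ wd h) = 1.
    apply/ab; first by rewrite size_cat size_word_inv; lia.
    by rewrite word_val_cat word_val_inv E mulVg.
  by rewrite word_val_cat word_val_inv => /(canRL (mulKVg _)); rewrite mulg1.
- move=> g h Fg Fh Fgh.
  have [sg eg] := wdP g Fg; have [sh eh] := wdP h Fh.
  have [sgh egh] := wdP _ Fgh.
  have : word_val a' b' (word_inv (wd (g * h)) ++ (wd g ++ wd h)) = 1.
    apply/ab; first by rewrite !size_cat size_word_inv; lia.
    by rewrite !word_val_cat word_val_inv eg eh egh mulVg.
  rewrite !word_val_cat word_val_inv => /(canRL (mulKVg _)).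
  by rewrite mulg1 => ->.
Qed.

Lemma subgroup_gen_words (G : groupType) (a b g : G) :
  subgroup_gen [set a; b]%classic g -> exists n, word_values a b n g.
Proof.
move/(_ [set g | exists u, g = word_val a b u]%classic).
case=> [|u ->]; last by exists (size u), u.
split=> [|_ [->|->]].
- split; first by exists [::]; rewrite /word_val big_nil.
  + by move=> _ _ [u ->] [v ->]; exists (u ++ v); rewrite word_val_cat.
  + by move=> _ [u ->]; exists (word_inv u); rewrite word_val_inv.
- by exists [:: (true, false)]; rewrite /word_val big_seq1.
- by exists [:: (false, false)]; rewrite /word_val big_seq1.
Qed.

(** This exchanges an arbitrary finite generating set for the two standard generators, at the cost
    of a factor [L] in word length. *)
Lemma finite_set_words (G : groupType) (a b : G) (S : set G) :
  finite_set S -> (S `<=` subgroup_gen [set a; b])%classic ->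
  exists L, (S `<=` word_values a b L)%classic.
Proof.
move=> /finite_seqP[s ->]; elim: s => [|x s IH] sub; first by exists 0.
have [|L hL] := IH; first by move=> y ys; apply: sub; rewrite /= inE ys orbT.
have [|n [u hu xu]] := @subgroup_gen_words _ a b x.
  by apply: sub; rewrite /= inE eqxx.
exists (maxn n L) => y; rewrite /= inE => /orP[/eqP ->|/hL[v hv yv]].
  by exists u => //; lia.
by exists v => //; lia.
Qed.

Lemma word_ball_words (G : groupType) (a b : G) (S : set G) L n g :
  (S `<=` word_values a b L)%classic -> word_ball S n g ->
  word_values a b (L * n) g.
Proof.
move=> SL [w [sw wS ->]].
suff [u su ->] : exists2 u, (size u <= L * size w)%N &
    \prod_(x <- w) x = word_val a b u by exists u => //; nia.
elim: w {sw} wS => [|x w IH] wS.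
  by exists [::]; rewrite // /word_val !big_nil.
have [|u su E] := IH; first by move=> y yw; apply: wS; rewrite inE yw orbT.
have [v sv ->] : exists2 v, (size v <= L)%N & x = word_val a b v.
  have [/SL[v sv ->]|/SL[v sv xv]] := wS x (mem_head _ _); first by exists v.
  by exists (word_inv v); rewrite ?size_word_inv // word_val_inv -xv invgK.
exists (v ++ u); first by rewrite size_cat /=; nia.
by rewrite big_cons E word_val_cat.
Qed.

(** * The finite quotient and its order *)

Lemma fact_le_exp2 m : (m`! <= 2 ^ (m * m))%N.
Proof.
elim: m => // m IH; rewrite factS.
apply: leq_trans (leq_mul (ltn_expl m (ltnSn 1)) IH) _.
by rewrite -expnD leq_exp2l //; nia.
Qed.

Section SmallQuotient.
Variables (f d p q : nat -> nat).
Hypothesis f_ge : forall n, (0 < n)%N -> (n <= f n)%N.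
Hypothesis Bf : B_parameters f d p q.
Variable N : nat.

Definition long_cycle n := (4 * p n + 4 * N < p n * q n)%N.

Definition short_p n := if long_cycle n then minn (p n) (4 * N).+1 else p n.

(** The value [8 * N + 9] is odd and ensures [4 p' + 4 N < p' q'] for every [p' >= 1]; the cap
    [(4 * N).+1] in [short_p] is odd too, as [cyc_trivial_compare] demands. *)
Definition short_q n := if long_cycle n then (8 * N + 9)%N else q n.

Definition short_d n := (short_p n * short_q n + 2)%N.

Lemma p_ge n : (0 < n)%N -> (n <= p n)%N.
Proof.
elim: n => [//|[|n] IH] _; first by rewrite (p_1 Bf).
by have := IH isT; have := p_incr Bf (m := n.+1) (n := n.+2) isT (ltnSn _); lia.
Qed.

(** By [d_ge] and [f_ge], [p q + 2 = d >= 8 p(n+1) + 8], and [p(n+1) > p(n)]. *)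
Lemma pq_ge n : (0 < n)%N -> (8 * p n + 6 <= p n * q n)%N.
Proof.
move=> n0; have := d_ge Bf n0; rewrite (d_eq Bf n0).
have := f_ge (n := 4 * p n.+1 + 4) ltac:(lia).
by have := p_incr Bf n0 (ltnSn n); lia.
Qed.

(** An unchanged coordinate has [8 p + 6 <= p q <= 4 p + 4 N], so [p < N] and its degree is linear
    in [N]. A replaced one has degree at most [(4 N + 1) (8 N + 9) + 2]. *)
Lemma short_d_le n : (0 < n)%N -> (short_d n <= 2 * (4 * N + 2) * (4 * N + 6))%N.
Proof.
rewrite /short_d /short_p /short_q => n0.
by case: ifP => [_|]; rewrite /long_cycle; have := pq_ge n0; nia.
Qed.

Lemma cyc_trivial_shorten n u : (0 < n)%N -> (size u <= N)%N ->
  cyc_trivial (d n) (q n) u <-> cyc_trivial (short_d n) (short_q n) u.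
Proof.
move=> n0 su; rewrite /short_d /short_q /short_p (d_eq Bf n0).
case: ifP => // long.
have po := p_odd Bf n0; have qo := q_odd Bf n0.
have po' : odd (minn (p n) (4 * N).+1).
  by rewrite /minn; case: ifP => //; rewrite /= oddM.
have qo' : odd (8 * N + 9) by rewrite oddD oddM.
have long' : (4 * minn (p n) (4 * N).+1 + 4 * N <
    minn (p n) (4 * N).+1 * (8 * N + 9))%N.
  by case: (minn _ _) po' => // m _; nia.
by split; apply: (@cyc_trivial_compare N) => //; lia.
Qed.

(** Here [p >= 4 N + 1] at both indices, so the two minima agree, and [pq_ge] yields
    [p q > 4 p + 4 N]. *)
Lemma cyc_trivial_stable m n u :
  (4 * N < m)%N -> (4 * N < n)%N -> (size u <= N)%N ->
  cyc_trivial (d m) (q m) u -> cyc_trivial (d n) (q n) u.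
Proof.
move=> mN nN su.
have m0 : (0 < m)%N by lia.
have n0 : (0 < n)%N by lia.
rewrite (d_eq Bf m0) (d_eq Bf n0).
have := p_ge m0; have := p_ge n0; have := pq_ge m0; have := pq_ge n0.
move=> hn hm pn pm; have pom := p_odd Bf m0; have qom := q_odd Bf m0.
have pon := p_odd Bf n0; have qon := q_odd Bf n0.
by apply: (@cyc_trivial_compare N) => //; lia.
Qed.

Definition short_product : finGroupType :=
  {dffun forall i : 'I_(4 * N).+1, 'S_(short_d i.+1)}.

Definition short_s : short_product :=
  [ffun i : 'I_(4 * N).+1 => alpha_perm (short_d i.+1) ^+ short_q i.+1].

Definition short_t : short_product :=
  [ffun i : 'I_(4 * N).+1 => beta_perm (short_d i.+1)].

Lemma sym_product_trivial u :
  word_val (gen_s d q) (gen_t d) u = 1 <->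
  forall n, (0 < n)%N -> cyc_trivial (d n) (q n) u.
Proof.
have E n : word_val (gen_s d q) (gen_t d) u n =
    word_val (alpha_perm (d n.+1) ^+ q n.+1) (beta_perm (d n.+1)) u.
  exact: (word_valM (phi := fun x : sym_product d => x n)).
split=> [u1 [//|n] _|u1]; first by rewrite /cyc_trivial -E u1.
by apply: functional_extensionality_dep => n; rewrite E; apply: u1.
Qed.

Lemma short_product_trivial u :
  word_val short_s short_t u = 1 <->
  forall n, (0 < n <= (4 * N).+1)%N -> cyc_trivial (short_d n) (short_q n) u.
Proof.
have E (i : 'I_(4 * N).+1) : word_val short_s short_t u i =
    word_val (alpha_perm (short_d i.+1) ^+ short_q i.+1)
             (beta_perm (short_d i.+1)) u.
  rewrite (word_valM (phi := fun x : short_product => x i)) ?ffunE //.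
  by move=> x y; rewrite mulg_ffun.
split=> [u1 [//|n] /andP[_ hn]|u1].
  by rewrite /cyc_trivial -(E (Ordinal hn)) u1 oneg_ffun.
apply/ffunP => i; rewrite E oneg_ffun; apply: u1.
by rewrite /= ltnS -ltnS.
Qed.

Lemma trivial_word_short u : (size u <= N)%N ->
  word_val (gen_s d q) (gen_t d) u = 1 <-> word_val short_s short_t u = 1.
Proof.
move=> su; rewrite sym_product_trivial short_product_trivial; split=> H n.
  by move=> /andP[n0 _]; apply/cyc_trivial_shorten => //; apply: H.
move=> n0; have [hn|hn] := leqP n (4 * N).+1.
  by apply/cyc_trivial_shorten => //; apply: H; rewrite n0.
(* The last kept coordinate, of index [4 N + 1], stands for all later ones. *)
apply: (@cyc_trivial_stable (4 * N).+1) => //; first by lia.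
by apply/cyc_trivial_shorten => //; apply: H; rewrite /=.
Qed.

Lemma card_short_product : (0 < N)%N ->
  (#|short_product| <= 2 ^ 2 ^ (22 * N))%N.
Proof.
move=> N0; set D := (2 * (4 * N + 2) * (4 * N + 6))%N.
have step1 : (#|short_product| <= (2 ^ (D * D)) ^ (4 * N).+1)%N.
  rewrite card_dep_ffun -[in leqRHS](card_ord (4 * N).+1) -sum1_card.
  rewrite foldrE big_image /= expn_sum; apply: leq_prod => i _.
  rewrite card_Sn expn1; apply: leq_trans (fact_le_exp2 _) _.
  by rewrite leq_exp2l // leq_mul // short_d_le.
apply: leq_trans step1 _; rewrite -expnM leq_exp2l //.
have hN : (N < 2 ^ N)%N by apply: ltn_expl.
(* With [x = 2 ^ N > N], the exponent splits as 22 = 9 + 9 + 4: [D <= x ^ 9] twice, and [x ^ 4]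
   bounds the number of factors. Constants are absorbed by powers of [x >= 2]. *)
rewrite (mulnC 22) expnM; move: (2 ^ N)%N hN => x hN.
have x2 : (2 <= x)%N by lia.
have pw m : (2 ^ m <= x ^ m)%N by case: m => // m; rewrite leq_exp2r.
have hD : (D <= x ^ 9)%N.
  rewrite (expnD x 7 2) (leq_trans _ (leq_mul (pw 7) (leqnn _))) //.
  by rewrite /D -[(x ^ 2)%N]mulnn (_ : 2 ^ 7 = 128)%N //; nia.
have hk : ((4 * N).+1 <= x ^ 4)%N.
  rewrite (expnD x 3 1) (leq_trans _ (leq_mul (pw 3) (leqnn _))) //.
  by rewrite expn1 (_ : 2 ^ 3 = 8)%N //; lia.
apply: (@leq_trans (x ^ 9 * x ^ 9 * x ^ 4)).
  exact: leq_mul (leq_mul hD hD) hk.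
by rewrite -!expnD.
Qed.

End SmallQuotient.

(** * The double exponential bound *)

Section Main.
Local Open Scope ring_scope.

Lemma exp2_le_expR (R : realType) m : (2 ^ m)%:R <= expR (m%:R : R).
Proof.
have e2 : 2 <= expR (1 : R) by have := expR_ge1Dx (1 : R); lra.
rewrite -[m%:R]mulr1 expRM_natl natrX.
by apply: lerXn2r; rewrite // nnegrE; lra.
Qed.

Lemma eval_real_nat (R : realType) (T : Type) (g : nat -> T) m :
  eval_real g (m%:R : R) = g m.
Proof.
rewrite /eval_real; have -> : m%:R = (m%:Z)%:~R :> R by [].
by rewrite intrKceil.
Qed.

Lemma LEF_growth_le (R : realType) (G : groupType) (S : set G) n m k :
  embeds_in_order (word_ball S n) m -> (m <= k)%N ->
  (LEF_growth R S n <= (k%:R)%:E)%E.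
Proof.
move=> Hm mk; rewrite /LEF_growth; case: pselect => [ex|nex]; last first.
  by case: nex; exists m; apply/asboolP.
rewrite lee_fin ler_nat; case: ex_minnP => m' _ min.
by apply: leq_trans mk; apply: min; apply/asboolP.
Qed.

End Main.

Theorem theorem1p5 (R : realType) (f : nat -> nat)
  (f_incr : forall m n : nat, (0 < m)%N -> (m <= n)%N -> (f m <= f n)%N)
  (f_ge : forall n : nat, (0 < n)%N -> (n <= f n)%N)
  (d p q : nat -> nat) (Bf : B_parameters f d p q)
  (S : set (sym_product d)) (S_fin : finite_set S)
  (S_gen : subgroup_gen S = N_group d q) :
  growth_le (@LEF_growth R (sym_product d) S)
            (fun n : nat => (expR (expR (n%:R : R)))%:E).
Proof.
have [|L SL] := @finite_set_words _ (gen_s d q) (gen_t d) S S_fin.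
  by move: S_gen; rewrite /N_group => <-; apply: sub_smallest.
(* The 22 comes from [card_short_product], the 3 from [embeds_word_values], and [L.+1] from the
   change of generators, with the successor making the constant positive. As [C] is a natural
   number, the ceiling has no effect. *)
exists (22 * (3 * L.+1))%:R%R; first by rewrite ltr0n.
move=> n n0; rewrite -natrM eval_real_nat.
pose N := (3 * (L.+1 * n))%N.
have N0 : (0 < N)%N by rewrite /N; nia.
apply: le_trans (_ : _ <= ((2 ^ 2 ^ (22 * N))%:R)%:E)%E _.
  apply: LEF_growth_le (card_short_product f_ge Bf N0).
  apply: (@embeds_word_values _ _ (gen_s d q) (gen_t d) _ _ (L.+1 * n)).
  - move=> g; apply: word_ball_words => h /SL[u su ->].
    by exists u => //; apply: leqW.
  - by move=> u su; apply: trivial_word_short f_ge Bf _ _ su.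
rewrite lee_fin (le_trans (exp2_le_expR _ _)) // ler_expR.
by rewrite (le_trans (exp2_le_expR _ _)) // /N !mulnA.
Qed.
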